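(* Let $k$ be a field, $R=k[x_1,\ldots,x_n]$, and let $F=\{x^{v_1},\ldots,x^{v_q}\}\subset R$ be a finite set of distinct monomials of the same degree $d\geq 2$, having no non-trivial common factor and such that every variable $x_i$ divides at least one member of $F$. Let $A$ be the log-matrix of $F$, let $S$ be the numerical linear syzygy matrix of $F$, and let $M=AS$. Let $\mathbf{x}_d$ be the set of all monomials of degree $d$ in $R$. Then: (i) If $\mathrm{rank}(M)=n-1$, then $k[F]\subset k[\mathbf{x}_d]$ is a birational extension. (ii) If $\mathrm{rank}(S)=q-1$ and $\mathrm{rank}(A)=n$, then $\mathrm{rank}(M)=n-1$. In particular, $k[F]\subset k[\mathbf{x}_d]$ is birational.
   Context: For $\alpha=(a_1,\ldots,a_n)\in\mathbb{N}^n$, $x^\alpha=x_1^{a_1}\cdots x_n^{a_n}$. The log-matrix of $F$ is the $n\times q$ integer matrix $A=(v_1,\ldots,v_q)$ whose columns are the exponent vectors. Let $e'_1,\ldots,e'_q$ be the canonical basis vectors of rank $q$. The matrix $\mathcal{LS}(F)$ of linear syzygies of $F$ is the matrix over $R$ with $q$ rows whose columns are all vectors of the form $x_ie'_j-x_ke'_\ell$ such that $x_ix^{v_j}=x_kx^{v_\ell}$. The numerical linear syzygy matrix $S$ is the integer matrix obtained from $\mathcal{LS}(F)$ by substituting $x_i=1$ for all $i$. Equivalently, the columns of $M=AS$ are the difference vectors $e_i-e_k$ ($e_1,\dots,e_n$ the canonical basis of $\mathbb{Z}^n$) such that $e_i-e_k=v_j-v_\ell$ for some $j,\ell\in\{1,\ldots,q\}$.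 Ranks of integer matrices are taken over $\mathbb{Q}$. $k[F]$ denotes the $k$-subalgebra of $R$ generated by $F$. An extension $D'\subset D$ of integral domains is birational if $D'$ and $D$ have the same field of fractions. *)

(* Defs.v *)
From HB Require Import structures.
From mathcomp Require Import all_boot all_order all_algebra.
From mathcomp Require Import mpoly.
Set Implicit Arguments.
Unset Strict Implicit.
Unset Printing Implicit Defensive.
Import GRing.Theory.
Local Open Scope ring_scope.

Definition rdivides (T : pzRingType) (a b : T) : Prop := exists c : T, b = a * c.

Definition subalgebra (k : nzRingType) (B : algType k) (D : B -> Prop) : Prop :=
  [/\ D 1,
      forall (c : k) (a : B), D a -> D (c *: a),
      forall a b : B, D a -> D b -> D (a + b)
    & forall a b : B, D a -> D b -> D (a * b)].

Definition gen_subalgebra (k : nzRingType) (B : algType k) (G : B -> Prop) (f : B)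
  : Prop :=
  forall D : B -> Prop, subalgebra D -> (forall g, G g -> D g) -> D f.

(* The field of fractions of a subdomain D of T, realised inside Frac(T). *)
Definition frac_field (T : idomainType) (D : T -> Prop) (z : {fraction T}) : Prop :=
  exists a b : T, [/\ D a, D b, b != 0 & z = tofrac a / tofrac b].

Definition birational (T : idomainType) (D' D : T -> Prop) : Prop :=
  (forall f, D' f -> D f) /\ (forall z, frac_field D' z <-> frac_field D z).

Definition rankQ (m n : nat) (B : 'M[int]_(m, n)) : nat :=
  \rank (map_mx (intr : int -> rat) B).

(* A finite set of q distinct monomials is given by the injective family
   v : 'I_q -> 'X_{1..n} of its exponent vectors. *)
Section Monomials.
Variables (n q : nat).
Implicit Type v : 'I_q -> 'X_{1..n}.

Definition monomials (k : fieldType) v (f : {mpoly k[n]}) : Prop :=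
  exists j : 'I_q, f = 'X_[v j].

Definition all_monomials (k : fieldType) (d : nat) (f : {mpoly k[n]}) : Prop :=
  exists m : 'X_{1..n}, mdeg m = d /\ f = 'X_[m].

Definition log_matrix v : 'M[int]_(n, q) := \matrix_(i, j) (v j i)%:Z.

(* The quadruples ((i, j), (k, l)) with x_i x^(v_j) = x_k x^(v_l), which index
   the columns of the linear syzygy matrix.  The trivial quadruples
   (i, j) = (k, l) are kept; they only contribute zero columns. *)
Definition linsyz_index v : {set ('I_n * 'I_q) * ('I_n * 'I_q)} :=
  [set c | (U_(c.1.1) + v c.1.2 == U_(c.2.1) + v c.2.2)%MM].

Definition linsyz_col (K : comNzRingType) (c : ('I_n * 'I_q) * ('I_n * 'I_q))
  : 'cV[{mpoly K[n]}]_q :=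
  'X_(c.1.1) *: delta_mx c.1.2 0 - 'X_(c.2.1) *: delta_mx c.2.2 0.

Definition linsyz_matrix (K : comNzRingType) v
  : 'M[{mpoly K[n]}]_(q, #|linsyz_index v|) :=
  \matrix_(r, c) linsyz_col K (enum_val c) r 0.

(* The coefficients of the linear syzygies are 0 and +-1, so they make sense
   over any K; working over K = int makes the specialisation x_i = 1 an integer
   matrix whatever the characteristic of the base field. *)
Definition num_linsyz_matrix v : 'M[int]_(q, #|linsyz_index v|) :=
  map_mx (meval (fun _ : 'I_n => 1)) (linsyz_matrix int v).

End Monomials.

Arguments monomials {n q} k v f.
Arguments all_monomials n k d f : clear implicits.

(* Main.v *)
Require Import Defs.
From mathcomp Require Import all_boot all_order all_algebra.
From mathcomp Require Import mpoly.
Set Implicit Arguments.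
Unset Strict Implicit.
Unset Printing Implicit Defensive.
Import GRing.Theory.
Local Open Scope ring_scope.

(** The column of M attached to a syzygy x_i x^(v_j) = x_k x^(v_l) is e_k - e_i,
    and then x_i / x_k = x^(v_l) / x^(v_j) lies in the fraction field of k[F].
    So M is the incidence matrix of the graph on the variables whose edges are
    these pairs.  If rank M = n - 1, this graph is connected: otherwise the
    indicator of a component and the all-ones vector would be two independent
    vectors in the left kernel of M.  Hence Frac k[F] contains every x_i / x_k,
    and therefore every x^m = x^(v_j) (x^m / x^(v_j)) with |m| = d.
    For (ii), the left kernel of S is the line spanned by the all-ones vector,
    which belongs to the row space of A because all the v_j have degree d; so
    rank (AS) = rank A - 1. *)

Lemma gen_subalgebra_subalgebra (k : nzRingType) (B : algType k)
  (G : B -> Prop) : subalgebra (gen_subalgebra G).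
Proof.
split=> [D [] // |c a Da D sD sG|a b Da Db D sD sG|a b Da Db D sD sG].
- by case: (sD) => _ + _ _; apply; apply: Da.
- by case: (sD) => _ _ + _; apply; [apply: Da | apply: Db].
- by case: (sD) => _ _ _; apply; [apply: Da | apply: Db].
Qed.

Lemma gen_subalgebra_incl (k : nzRingType) (B : algType k) (G : B -> Prop) g :
  G g -> gen_subalgebra G g.
Proof. by move=> Gg D _; apply. Qed.

Lemma tofrac_mpolyX_neq0 (k : fieldType) (n : nat) (m : 'X_{1..n}) :
  tofrac ('X_[m] : {mpoly k[n]}) != 0.
Proof.
by rewrite tofrac_eq0; apply/eqP=> /(congr1 (mcoeff m))/eqP;
   rewrite mcoeffX eqxx mcoeff0 oner_eq0.
Qed.

(** * Fractions over a subalgebra of the polynomial ring *)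

Section FracField.
Variables (k : fieldType) (n : nat) (D : {mpoly k[n]} -> Prop).
Hypothesis subD : subalgebra D.
Implicit Types (x y : {fraction {mpoly k[n]}}) (f : {mpoly k[n]}).

Lemma frac_field_incl f : D f -> frac_field D (tofrac f).
Proof.
case: subD => D1 _ _ _ Df; exists f, 1.
by rewrite oner_eq0 tofrac1 divr1.
Qed.

Lemma frac_field1 : frac_field D 1.
Proof. by rewrite -tofrac1; apply: frac_field_incl; case: subD. Qed.

Lemma frac_fieldM x y : frac_field D x -> frac_field D y -> frac_field D (x * y).
Proof.
case: subD => _ _ _ DM [a [b [Da Db b0 ->]]] [c [e [Dc De e0 ->]]].
exists (a * c), (b * e); split; [exact: DM | exact: DM | by rewrite mulf_neq0 |].
by rewrite !tofracM invfM mulrACA.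
Qed.

Lemma frac_fieldD x y : frac_field D x -> frac_field D y -> frac_field D (x + y).
Proof.
case: subD => _ _ DD DM [a [b [Da Db b0 ->]]] [c [e [Dc De e0 ->]]].
exists (a * e + c * b), (b * e).
split; [by apply: DD; apply: DM | exact: DM | by rewrite mulf_neq0 |].
by rewrite tofracD !tofracM addf_div ?tofrac_eq0.
Qed.

Lemma frac_fieldV x : frac_field D x -> frac_field D x^-1.
Proof.
case=> a [b [Da Db b0 ->]]; have [->|a0] := eqVneq a 0.
  (* Since the inverse of 0 is 0 by convention, a fraction with numerator 0 is needed; 0 lies in [D]
     as the scalar 0 times 1. *)
  by rewrite tofrac0 mul0r invr0 -(mul0r (tofrac b)^-1) -tofrac0; exists 0, b;
     split=> //; case: subD => D1 DZ _ _; rewrite -(scale0r 1); apply: DZ.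
by exists b, a; rewrite invfM invrK mulrC.
Qed.

Lemma frac_field_div x y :
  frac_field D x -> frac_field D y -> frac_field D (x / y).
Proof. by move=> Fx Fy; apply: frac_fieldM => //; apply: frac_fieldV. Qed.

Lemma frac_fieldX x m : frac_field D x -> frac_field D (x ^+ m).
Proof.
move=> Fx; elim: m => [|m IHm]; first by rewrite expr0; apply: frac_field1.
by rewrite exprS; apply: frac_fieldM.
Qed.

(** This reduces membership in the fraction field to generators: a subalgebra containing them
    contains everything they generate. *)
Lemma frac_field_subalgebra : subalgebra (fun f => frac_field D (tofrac f)).
Proof.
split=> [|c f Ff|f g Ff Fg|f g Ff Fg].
- by rewrite tofrac1; apply: frac_field1.
- rewrite -mul_mpolyC tofracM; apply: frac_fieldM => //; apply: frac_field_incl.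
  by case: subD => D1 DZ _ _; rewrite -[c%:MP]mulr1 mul_mpolyC; apply: DZ.
- by rewrite tofracD; apply: frac_fieldD.
- by rewrite tofracM; apply: frac_fieldM.
Qed.

(** The quotient has degree 0, so each variable of the monomial, counted with multiplicity, can be
    paired with one factor ['X_i0] of the denominator. *)
Lemma frac_field_monomial_ratio (i0 : 'I_n) (m : 'X_{1..n}) :
  (forall i : 'I_n, frac_field D (tofrac 'X_i / tofrac 'X_i0)) ->
  frac_field D (tofrac 'X_[m] / tofrac 'X_i0 ^+ mdeg m).
Proof.
move=> Fratio.
have -> : tofrac 'X_[m] / tofrac 'X_i0 ^+ mdeg m
        = \prod_(i < n) (tofrac ('X_i : {mpoly k[n]}) / tofrac 'X_i0) ^+ m i.
  rewrite mpolyXE_id rmorph_prod mdegE -prodrXr -prodf_div.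
  by apply: eq_bigr => i _; rewrite rmorphXn expr_div_n.
apply: big_ind => [|x y|i _]; [exact: frac_field1 | exact: frac_fieldM |].
exact: frac_fieldX.
Qed.

End FracField.

Lemma birational_gen_subalgebra (k : fieldType) (n : nat)
  (G H : {mpoly k[n]} -> Prop) :
  (forall f, G f -> H f) ->
  (forall f, H f -> frac_field (gen_subalgebra G) (tofrac f)) ->
  birational (gen_subalgebra G) (gen_subalgebra H).
Proof.
move=> GH HF; have sG := gen_subalgebra_subalgebra G.
have GHsub f : gen_subalgebra G f -> gen_subalgebra H f.
  by move=> Gf D sD DH; apply: Gf => // g /GH; apply: DH.
split=> // z; split=> [[a [b [Da Db b0 ->]]]|[a [b [Da Db _ ->]]]].
  by exists a, b; split; auto.
have HFsub f : gen_subalgebra H f -> frac_field (gen_subalgebra G) (tofrac f).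
  by move=> Hf; apply: (Hf _ (frac_field_subalgebra sG)).
by apply: frac_field_div => //; apply: HFsub.
Qed.

(** By rank-nullity the left kernel has dimension at most 1, and it contains the nonzero vector
    [w]. *)
Lemma kermx_corank1 (F : fieldType) (n p : nat) (B : 'M[F]_(n, p))
  (w : 'rV[F]_n) :
  w != 0 -> w *m B = 0 -> (n <= (\rank B).+1)%N -> (kermx B == w)%MS.
Proof.
move=> w0 wB rkB; have wK : (w <= kermx B)%MS by apply/sub_kermxP.
have rk_le : (\rank (kermx B) <= \rank w)%N.
  by rewrite mxrank_ker rank_rV w0 leq_subLR addn1.
by rewrite wK andbT -(geq_leqif (mxrank_leqif_sup wK)).
Qed.

(** * Linear syzygies and their graph on the variables *)

Section Syzygies.
Variables (n q : nat) (v : 'I_q -> 'X_{1..n}).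

Lemma num_linsyz_matrixE (r : 'I_q) c :
  num_linsyz_matrix v r c =
    ((enum_val c).1.2 == r)%:R - ((enum_val c).2.2 == r)%:R.
Proof.
rewrite !mxE rmorphB !rmorphM /= !mevalXU !mul1r !rmorph_nat !eqxx !andbT.
by rewrite ![r == _]eq_sym.
Qed.

Lemma mul_num_linsyzE m (W : 'M[int]_(m, q)) i c :
  (W *m num_linsyz_matrix v) i c =
    W i (enum_val c).1.2 - W i (enum_val c).2.2.
Proof.
rewrite mxE; under eq_bigr do rewrite num_linsyz_matrixE mulrBr !mulr_natr !mulrb.
rewrite sumrB -!big_mkcond /=.
by rewrite !(eq_bigl _ _ (fun r => eq_sym _ r)) !big_pred1_eq.
Qed.

(** Comparing the exponents of ['X_i] on both sides of the syzygy turns a difference of columns of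
    the log-matrix into a difference of basis vectors. *)
Lemma log_mul_num_linsyzE (i : 'I_n) c :
  (log_matrix v *m num_linsyz_matrix v) i c =
    ((enum_val c).2.1 == i)%:R - ((enum_val c).1.1 == i)%:R.
Proof.
rewrite mul_num_linsyzE !mxE.
have := enum_valP c; rewrite inE => /eqP/mnmP/(_ i).
rewrite !mnmDE !mnm1E => /(congr1 Posz); rewrite !PoszD => e.
by apply/eqP; rewrite !natz subr_eq addrAC eq_sym subr_eq -e addrC.
Qed.

Lemma mul_log_num_linsyzE (w : 'I_n -> int) c :
  ((\row_i w i) *m (log_matrix v *m num_linsyz_matrix v)) 0 c =
    w (enum_val c).2.1 - w (enum_val c).1.1.
Proof.
rewrite mxE.
under eq_bigr do rewrite log_mul_num_linsyzE mxE mulrBr !mulr_natr !mulrb.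
rewrite sumrB -!big_mkcond /=.
by rewrite !(eq_bigl _ _ (fun r => eq_sym _ r)) !big_pred1_eq.
Qed.

Definition linsyz_adj : rel 'I_n :=
  fun i k => [exists j, exists l, (U_(i) + v j == U_(k) + v l)%MM].

Lemma linsyz_adj_sym : connect_sym linsyz_adj.
Proof.
apply: sym_connect_sym => i l; apply/idP/idP => /existsP[j /existsP[r e]];
  by apply/existsP; exists r; apply/existsP; exists j; rewrite eq_sym.
Qed.

(** The ratio telescopes along a path, and each edge contributes a quotient of two members of F. *)
Lemma frac_field_linsyz_connect (k : fieldType) (i l : 'I_n) :
  connect linsyz_adj i l ->
  frac_field (gen_subalgebra (monomials k v)) (tofrac 'X_i / tofrac 'X_l).
Proof.
have sD := gen_subalgebra_subalgebra (monomials k v).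
have X0 m := tofrac_mpolyX_neq0 k m.
case/connectP=> p + ->; elim: p i => [|h p IHp] i /=.
  by rewrite divff ?X0 // => _; apply: frac_field1.
case/andP=> /existsP[j /existsP[r /eqP e]] /IHp Fh.
have -> : tofrac ('X_i : {mpoly k[n]}) / tofrac 'X_(last h p)
       = tofrac 'X_[v r] / tofrac 'X_[v j] * (tofrac 'X_h / tofrac 'X_(last h p)).
  rewrite mulrA; congr (_ / _); rewrite mulrAC -tofracM -mpolyXD.
  by rewrite addmC -e mpolyXD tofracM mulfK ?X0.
apply: frac_fieldM => //; apply: frac_field_div => //;
  by apply: frac_field_incl => //; apply: gen_subalgebra_incl; eexists.
Qed.

Lemma rank_log_connect (i l : 'I_n) :
  rankQ (log_matrix v *m num_linsyz_matrix v) = (n - 1)%N ->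
  connect linsyz_adj i l.
Proof.
rewrite /rankQ; set M := _ *m _; set B := map_mx _ _ => rkM.
(* A function constant along the edges is a vector of the left kernel of [M]. *)
have ker (w : 'I_n -> int) :
    (forall h r, linsyz_adj h r -> w h = w r) ->
    map_mx (intr : int -> rat) (\row_h w h) *m B = 0.
  move=> w_adj; rewrite -map_mxM; apply/rowP=> c.
  rewrite mxE mul_log_num_linsyzE [RHS]mxE (w_adj _ (enum_val c).1.1) ?subrr //.
  have := enum_valP c; rewrite inE eq_sym => e.
  by apply/existsP; exists (enum_val c).2.2; apply/existsP; exists (enum_val c).1.2.
have /andP[le_ker _] : (kermx B == map_mx intr (\row_(_ < n) 1))%MS.
  apply: kermx_corank1; [|exact: ker|by rewrite rkM subn1 leqSpred].
  by apply/eqP=> /rowP/(_ i); rewrite !mxE.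
(* The indicator of the component of [i] is such a function, hence a multiple [a] of the all-ones
   vector. *)
have /sub_kermxP/submx_trans/(_ le_ker)/sub_rVP[a e] :
    map_mx (intr : int -> rat) (\row_h (connect linsyz_adj i h)%:R) *m B = 0.
  apply: ker => h r /connect1 hr; congr (nat_of_bool _)%:R.
  by rewrite (same_connect_r linsyz_adj_sym hr).
(* The entry at [i] forces [a] to be 1, so the indicator is 1 at [l] too. *)
move/matrixP: e => e; have := e 0 i; have := e 0 l.
rewrite !mxE connect0 => <-.
by case: connect.
Qed.

End Syzygies.


(** * Monomials of equal degree *)

Section EqualDegree.
Variables (n q d : nat) (v : 'I_q -> 'X_{1..n}).
Hypothesis degv : forall j, mdeg (v j) = d.

Lemma ones_mul_log_matrix : const_mx 1 *m log_matrix v = const_mx d%:Z :> 'rV_q.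
Proof.
apply/rowP=> j; rewrite !mxE; under eq_bigr do rewrite !mxE mul1r.
by rewrite -(degv j) mdegE -!natz natr_sum; apply: eq_bigr => i _; rewrite natz.
Qed.

Lemma rank_log_mul_num_linsyz :
  (0 < d)%N -> (0 < q)%N -> rankQ (num_linsyz_matrix v) = (q - 1)%N ->
  rankQ (log_matrix v) = n ->
  rankQ (log_matrix v *m num_linsyz_matrix v) = (n - 1)%N.
Proof.
rewrite /rankQ map_mxM; set A := map_mx _ (log_matrix v).
set S := map_mx _ (num_linsyz_matrix v) => d_gt0 q_gt0 rkS rkA.
pose w : 'rV[rat]_q := const_mx 1.
have w0 : w != 0 by apply/eqP=> /rowP/(_ (Ordinal q_gt0)); rewrite !mxE.
have wS : w *m S = 0.
  have -> : w = map_mx (intr : int -> rat) (const_mx 1) by rewrite map_const_mx.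
  rewrite -map_mxM; apply/rowP=> c.
  by rewrite mxE mul_num_linsyzE !mxE subrr.
have wA : (w <= A)%MS.
  (* The rows of [A] add up to the constant vector [d], which is invertible in the rationals because
     [d] is positive. *)
  have -> : w = (d%:R^-1 *: const_mx 1) *m A.
    have -> : const_mx 1 = map_mx (intr : int -> rat) (const_mx 1 : 'rV_n).
      by rewrite map_const_mx.
    rewrite -scalemxAl -map_mxM ones_mul_log_matrix; apply/rowP=> j; rewrite !mxE.
    by rewrite /= -pmulrn mulVf // Num.Theory.pnatr_eq0 -lt0n.
  exact: submxMl.
have kerw : (kermx S == w)%MS.
  by apply: kermx_corank1 => //; rewrite rkS subn1 leqSpred.
have rk1 : \rank (A :&: kermx S)%MS = 1%N.
  rewrite (cap_eqmx (eqmx_refl A) (eqmxP kerw)).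
  by rewrite (capmx_idPr wA) rank_rV w0.
(* The rank of [A *m S] plus the dimension 1 of this intersection is the rank [n] of [A]. *)
by have := mxrank_mul_ker A S; rewrite rk1 rkA => /(congr1 predn); rewrite addn1 subn1.
Qed.

Lemma birational_of_rank (k : fieldType) (j0 : 'I_q) :
  (0 < d)%N -> rankQ (log_matrix v *m num_linsyz_matrix v) = (n - 1)%N ->
  birational (gen_subalgebra (monomials k v)) (gen_subalgebra (all_monomials n k d)).
Proof.
move=> d_gt0 rkM; have sD := gen_subalgebra_subalgebra (monomials k v).
apply: birational_gen_subalgebra => [f [j ->]|f [m [degm ->]]].
  by exists (v j).
(* Without variables every monomial would have degree 0, against [d_gt0]. *)
have [i0 _] : exists i0 : 'I_n, true.
  case: (pickP 'I_n) => [i|no_i]; first by exists i.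
  by move: d_gt0; rewrite -(degv j0) mdegE big_pred0.
have Fratio i : frac_field (gen_subalgebra (monomials k v))
    (tofrac 'X_i / tofrac 'X_i0).
  exact/frac_field_linsyz_connect/rank_log_connect.
have X0 u := tofrac_mpolyX_neq0 k u.
have := frac_field_monomial_ratio sD m Fratio.
have := frac_field_monomial_ratio sD (v j0) Fratio.
rewrite degm degv => Fv Fm.
(* Both monomials have degree [d], so the same power of ['X_i0] normalises them and cancels. *)
have -> : tofrac ('X_[m] : {mpoly k[n]}) = tofrac 'X_[v j0] *
    (tofrac 'X_[m] / tofrac 'X_i0 ^+ d / (tofrac 'X_[v j0] / tofrac 'X_i0 ^+ d)).
  by rewrite -mulf_div divff ?invr_eq0 ?expf_neq0 ?X0 // mulr1 mulrC divfK ?X0.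
apply: frac_fieldM => //; last exact: frac_field_div.
by apply: frac_field_incl => //; apply: gen_subalgebra_incl; exists j0.
Qed.

End EqualDegree.

Theorem proposition2p3 (k : fieldType) (n q d : nat) (v : 'I_q -> 'X_{1..n})
  (hd : (2 <= d)%N)
  (hinj : injective v)
  (hdeg : forall j : 'I_q, mdeg (v j) = d)
  (hgcd : forall g : {mpoly k[n]},
     (forall j : 'I_q, rdivides g 'X_[v j]) -> g \is a GRing.unit)
  (hvar : forall i : 'I_n, exists j : 'I_q,
     rdivides ('X_i : {mpoly k[n]}) 'X_[v j]) :
  let A := log_matrix v in
  let S := num_linsyz_matrix v in
  let M := A *m S in
  let kF := gen_subalgebra (monomials k v) in
  let kxd := gen_subalgebra (all_monomials n k d) in
  (rankQ M = (n - 1)%N -> birational kF kxd) /\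
  (rankQ S = (q - 1)%N -> rankQ A = n ->
     rankQ M = (n - 1)%N /\ birational kF kxd).
Proof.
have d_gt0 : (0 < d)%N by exact: ltnW.
(* If F were empty, then 0 would be a common factor, hence a unit. *)
have [j0 _] : exists j0 : 'I_q, true.
  case: (pickP 'I_q) => [j|no_j]; first by exists j.
  have /hgcd : forall j, rdivides (0 : {mpoly k[n]}) 'X_[v j].
    by move=> j; have := no_j j.
  by rewrite unitr0.
have bir := birational_of_rank hdeg k j0 d_gt0.
split=> // rkS rkA.
suff rkM : rankQ (log_matrix v *m num_linsyz_matrix v) = (n - 1)%N.
  by split=> //; apply: bir.
by apply: rank_log_mul_num_linsyz hdeg d_gt0 _ rkS rkA; case: (j0) => j /(leq_trans _); apply.
Qed.
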